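(* Let $\varepsilon>0$ and let $\mathcal T$ be a finite set of hypothesis models such that at least one $T^*\in\mathcal T$ has $err(T^* )\le\varepsilon$. Suppose the class $\mathcal P$ satisfies the boundedness assumption. If the maximum likelihood algorithm is run on $\mathcal T$ using a set $S$ of $m$ independent samples drawn from $\mathrm{Gen}$, then with probability at least $1-\delta$ it outputs some $\hat T\in\mathcal T$ with $err(\hat T)\le4\varepsilon$, where $\delta\le(|\mathcal T|+1)\exp\!\left(\frac{-2m\varepsilon^2}{M^2}\right)$.
   Context: $\mathcal X$ is a space of contexts, $\mathcal Y$ a space of outcomes. $\mathcal C$ is a class of $\{0,1\}$-valued functions on $\mathcal X$ and $\mathcal P$ a class of distributions over $\mathcal Y$. Boundedness assumption: there is $M$ such that $\log(1/P(y))\le M$ for all $P\in\mathcal P$, $y\in\mathcal Y$. Given a distribution $\mathcal D$ on $\mathcal X$, target $c\in\mathcal C$ and $P_0,P_1\in\mathcal P$, $\mathrm{Gen}$ draws $x\sim\mathcal D$, then $y\sim P_{c(x)}$, returns $(x,y)$. A hypothesis model is $T=(h,\hat P_0,\hat P_1)\in\mathcal C\times\mathcal P\times\mathcal P$ with $err(T)=\mathbb E_{x\sim\mathcal D}[\mathrm{KL}(P_{c(x)}\|\hat P_{h(x)})]$. The maximum likelihood algorithm, given a list $\mathcal T$ and a sample $S$ of pairs $(x,y)$, computes for each $T=(h,\hat P_0,\hat P_1)\in\mathcal T$ the log-loss $\mathrm{loss}(S,T)=\sum_{(x,y)\in S}-\log\hat P_{h(x)}(y)$ and outputs a $T\in\mathcal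 T$ minimizing $\mathrm{loss}(S,T)$. *)

(* Defs.v *)
From HB Require Import structures.
From mathcomp Require Import all_boot all_order all_algebra.
From mathcomp Require Import all_classical all_reals all_analysis.
From mathcomp Require Import measurable_realfun.

Set Implicit Arguments.
Unset Strict Implicit.
Unset Printing Implicit Defensive.

Import Order.TTheory GRing.Theory Num.Theory.

Local Open Scope classical_set_scope.
Local Open Scope ring_scope.
Local Open Scope charge_scope.
Local Open Scope ereal_scope.

Section kullback_leibler.
Context d (Y : measurableType d) (R : realType).

(* The integrand is log (dP/dQ), which is log (P(y) / Q(y)) for discrete
   distributions; the divergence is +oo when P is not absolutely continuous
   with respect to Q. *)
Definition KL (P Q : probability Y R) : \bar R :=
  if `[< P `<< Q >]
  then \int[P]_y lne (('d (charge_of_finite_measure P) '/d Q) y)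
  else +oo.

(* P(y) is the probability of the outcome y. The inverse and the logarithm are
   those of the extended reals, so that log (1 / P(y)) = +oo when P(y) = 0. *)
Definition bounded_class (PP : set (probability Y R)) (M : R) : Prop :=
  forall P y, PP P -> lne ((P [set y])^-1) <= M%:E.

End kullback_leibler.

Section gen.
Context dX (X : measurableType dX) dY (Y : measurableType dY) (R : realType).

Definition label_dist (P0 P1 : probability Y R) (b : bool) : probability Y R :=
  if b then P1 else P0.

Variables (D : probability X R) (c : {mfun X >-> bool}).
Variables (P0 P1 : probability Y R).

(* Joint law of (x, y) with x drawn from D, then y drawn from P_{c(x)}. *)
Definition gen (A : set (X * Y)) : \bar R :=
  \int[D]_x label_dist P0 P1 (c x) (xsection A x).

Let gen0 : gen set0 = 0.
Proof. by apply: integral0_eq => x _; rewrite xsection0 measure0. Qed.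

Let gen_ge0 A : 0 <= gen A.
Proof. by apply: integral_ge0 => x _; exact: measure_ge0. Qed.

Let gen_meas A : measurable A ->
  measurable_fun [set: X]
    (fun x => label_dist P0 P1 (c x) (xsection A x)).
Proof.
move=> mA; rewrite (_ : (fun x => _) = (fun x =>
    if c x then P1 (xsection A x) else P0 (xsection A x))); last first.
  by apply/funext => x; rewrite /label_dist; case: (c x).
by apply: measurable_fun_ifT; [|exact: measurable_fun_xsection..].
Qed.

Let gen_sigma_additive : semi_sigma_additive gen.
Proof.
move=> F mF tF mUF.
rewrite [X in _ --> X](_ : _ = \sum_(n <oo) gen (F n)).
  by apply/cvg_closeP; split; [exact: is_cvg_nneseries|rewrite closeE].
rewrite /gen -integral_nneseries//; last by move=> n; exact: gen_meas.
apply: eq_integral => x _; apply/esym/cvg_lim => //=; rewrite xsection_bigcup.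
apply: (measure_sigma_additive _ (trivIset_xsection tF)) => ?.
exact: measurable_xsection.
Qed.

HB.instance Definition _ := isMeasure.Build _ _ _ gen
  gen0 gen_ge0 gen_sigma_additive.

Let gen_setT : gen setT = 1.
Proof.
rewrite -(@probability_setT _ _ _ D) -[RHS]mul1e -integral_cst//.
apply: eq_integral => x _; rewrite (_ : xsection setT x = setT).
  exact: probability_setT.
by apply/seteqP; split => // y _; rewrite /xsection/= inE.
Qed.

HB.instance Definition _ := Measure_isProbability.Build _ _ _ gen gen_setT.

Definition Gen : probability (X * Y)%type R := gen.

End gen.

Section iid.
Context dO (Omega : measurableType dO) dZ (Z : measurableType dZ) (R : realType).
Variables (Pr : probability Omega R) (m : nat).

Definition independent_variables (S : 'I_m -> {mfun Omega >-> Z}) : Prop :=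
  forall (J : {set 'I_m}) (A : 'I_m -> set Z), (forall i, measurable (A i)) ->
    Pr (\bigcap_(i in [set i | i \in J]) (S i @^-1` A i)) =
    \prod_(i in J) Pr (S i @^-1` A i).

Definition iid_samples (Q : probability Z R)
    (S : 'I_m -> {mfun Omega >-> Z}) : Prop :=
  independent_variables S /\
  forall i A, measurable A -> Pr (S i @^-1` A) = Q A.

End iid.

Section models.
Context dX (X : measurableType dX) dY (Y : measurableType dY) (R : realType).

Record model := Model {
  hyp : {mfun X >-> bool} ;
  dist0 : probability Y R ;
  dist1 : probability Y R }.

Definition in_classes (C : set {mfun X >-> bool})
    (PP : set (probability Y R)) (T : model) : Prop :=
  [/\ C (hyp T), PP (dist0 T) & PP (dist1 T)].

Definition predicted (T : model) (x : X) : probability Y R :=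
  label_dist (dist0 T) (dist1 T) (hyp T x).

Definition err (D : probability X R) (c : {mfun X >-> bool})
    (P0 P1 : probability Y R) (T : model) : \bar R :=
  \int[D]_x KL (label_dist P0 P1 (c x)) (predicted T x).

Definition log_loss (s : seq (X * Y)) (T : model) : \bar R :=
  \sum_(z <- s) - lne (predicted T z.1 [set z.2]).

(* The algorithm is free to break ties: it may output any minimizer. *)
Definition max_likelihood_output (TT : set model) (s : seq (X * Y))
    (T : model) : Prop :=
  TT T /\ forall T', TT T' -> log_loss s T <= log_loss s T'.

End models.

(* Main.v *)
(* Boundedness forces every P in the class to give each outcome mass at least
   e^-M, so there are finitely many outcomes, and the log-loss of a model
   T = (h, Q0, Q1) on (x, y) depends only on the label (c x, h x, y), which
   takes finitely many values. Its mean is err(T) + H, where the entropy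
   H = E[-log P_{c(x)}(y)] is the same for all T, and its range lies in [0, M].
   By Hoeffding's inequality, outside an event of probability at most
   (|TT| + 1) exp (-2 m eps^2 / M^2), the empirical loss of T* is below
   m (H + 2 eps) while that of every T with err(T) > 4 eps is above
   m (H + 3 eps), so no such T is a minimizer. *)
Require Import Defs.
From HB Require Import structures.
From mathcomp Require Import all_boot all_order all_algebra.
From mathcomp Require Import all_classical all_reals all_analysis.
From mathcomp Require Import measurable_realfun ring lra.

Import Order.TTheory GRing.Theory Num.Theory.
Import numFieldNormedType.Exports.

Set Implicit Arguments.
Unset Strict Implicit.

Local Open Scope classical_set_scope.
Local Open Scope ring_scope.

(** * Exponential inequalities on the real line *)

(** Two uses of the mean value theorem: [f u] equals [f' v * u], and [f' v] equals [f'' w * v], with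
    [v] in [0, u]. *)
Lemma second_order_ge0 (R : realType) (f f' f'' : R -> R) (u : R) :
  (forall x : R, is_derive x 1 f (f' x)) ->
  (forall x : R, is_derive x 1 f' (f'' x)) ->
  (forall x, 0 <= f'' x) -> f 0 = 0 -> f' 0 = 0 -> 0 <= u -> 0 <= f u.
Proof.
move=> df df' f''0 f0 f'0 u0.
have cts (g g' : R -> R) (a b : R) : (forall x : R, is_derive x 1 g (g' x)) ->
    {within `[a, b], continuous g}.
  move=> dg; apply: derivable_within_continuous => x _.
  by have := dg x => ?; exact: ex_derive.
have [v /[!in_itv]/= /andP[v0 _]] :=
  MVT_segment u0 (fun x _ => df x) (cts _ _ _ _ df).
rewrite f0 !subr0 => ->; apply: mulr_ge0 => //.
have [w _] := MVT_segment v0 (fun x _ => df' x) (cts _ _ _ _ df').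
by rewrite f'0 !subr0 => ->; exact: mulr_ge0.
Qed.

(** Convexity of the exponential between 0 and [u]. The tangent at [l * u] lies below the curve at
    both endpoints; averaging these two bounds with weights [1 - l] and [l] cancels the linear
    terms. *)
Lemma expR_chord (R : realType) (l u : R) : 0 <= l <= 1 ->
  expR (l * u) <= 1 - l + l * expR u.
Proof.
move=> /andP[l0 l1].
have -> : expR u = expR (l * u) * expR ((1 - l) * u).
  by rewrite -expRD; congr expR; ring.
have : 1 + (1 - l) * u <= expR ((1 - l) * u) by exact: expR_ge1Dx.
have : 1 + - (l * u) <= expR (- (l * u)) by exact: expR_ge1Dx.
have : expR (l * u) * expR (- (l * u)) = 1 by rewrite -expRD subrr expR0.
have := expR_gt0 (l * u).
move: (expR (l * u)) (expR (- (l * u))) (expR ((1 - l) * u)).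
move=> a b d a0 ab hb hd.
have h1 : a * (1 + (1 - l) * u) <= a * d by rewrite ler_pM2l.
have h2 : a * (1 - l * u) <= 1 by rewrite -[leRHS]ab ler_pM2l.
have h3 : l * (a * (1 + (1 - l) * u)) <= l * (a * d) by exact: ler_wpM2l.
have h4 : (1 - l) * (a * (1 - l * u)) <= 1 - l.
  by rewrite -[leRHS]mulr1 ler_wpM2l // subr_ge0.
lra.
Qed.

(** Hoeffding's lemma for a Bernoulli variable. After taking logarithms, the difference of the two
    sides vanishes to first order at 0 and has nonnegative second derivative. *)
Lemma bernoulli_mgf_le (R : realType) (p u : R) : 0 <= p <= 1 ->
  1 - p + p * expR u <= expR (p * u + u ^+ 2 / 8).
Proof.
have den_gt0 (q x : R) : 0 <= q <= 1 -> 0 < 1 - q + q * expR x.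
  move=> /andP[q0 q1]; have := expR_gt0 x => ex0.
  have [->|/eqP qN0] := eqVneq q 0; first by lra.
  have : 0 < q by lra.
  move=> qp; have : 0 < q * expR x by exact: mulr_gt0.
  by lra.
(* (p, u) |-> (1 - p, - u) multiplies both sides by expR (- u). *)
wlog u0 : p u / 0 <= u => [hwlog p01|].
  have [/hwlog->//|ult0] := leP 0 u.
  have p01' : 0 <= 1 - p <= 1 by lra.
  have Nu0 : 0 <= - u by rewrite oppr_ge0 ltW.
  have := ler_wpM2l (expR_ge0 u) (hwlog _ _ Nu0 p01').
  rewrite -expRD.
  have -> : u + ((1 - p) * - u + (- u) ^+ 2 / 8) = p * u + u ^+ 2 / 8 by field.
  have -> : expR u * (1 - (1 - p) + (1 - p) * expR (- u)) =
      p * expR u + (1 - p) * (expR u * expR (- u)) by ring.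
  by rewrite -expRD subrr expR0 mulr1 addrC.
move=> p01; rewrite -[leLHS]lnK ?posrE ?den_gt0// ler_expR -subr_ge0.
pose den x := 1 - p + p * expR x.
pose f x := p * x + x ^+ 2 / 8 - ln (den x).
pose f' x := p + x / 4 - p * expR x / den x.
(* With q = [p * expR x / den x], the mean of the exponentially tilted Bernoulli law, this is 1/4 -
   q (1 - q) = (1/2 - q)^2. The bound 1/4 on the variance is the source of the constant 8. *)
pose f'' x := 1 / 4 - p * expR x / den x * (1 - p * expR x / den x).
have dden (x : R) : is_derive x 1 den (p * expR x).
  have h := is_deriveD (is_derive_cst (1 - p) x 1)
                       (is_deriveZ p (is_derive_expR x)).
  by apply: (is_derive_eq h); rewrite add0r.
have d0 x : 0 < den x by exact: den_gt0.
have df (x : R) : is_derive x 1 f (f' x).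
  have dl :=
    @is_derive1_comp _ (@ln R) den x _ _ (is_derive1_ln (d0 x)) (dden x).
  have di := is_derive_id x (1 : R).
  have := is_deriveB (is_deriveD (is_deriveZ p di)
                                 (is_deriveZ 8^-1 (is_deriveM di di))) dl.
  rewrite (_ : _ - _ = f); last first.
    by apply/funext => y; rewrite /f !fctE expr2 [_ / 8]mulrC.
  move=> h; apply: (is_derive_eq h); rewrite /GRing.scale /= /f'; field.
  by rewrite gt_eqF.
have df' (x : R) : is_derive x 1 f' (f'' x).
  have dV := is_deriveV (lt0r_neq0 (d0 x)) (dden x).
  have di := is_derive_id x (1 : R).
  have := is_deriveB (is_deriveD (is_derive_cst p x (1 : R))
                                 (is_deriveZ 4^-1 di))
                     (is_deriveZ p (is_deriveM (is_derive_expR x) dV)).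
  rewrite (_ : _ - _ = f'); last first.
    by apply/funext => y; rewrite /f' !fctE [_ / 4]mulrC -mulrA.
  move=> h; apply: (is_derive_eq h); rewrite /GRing.scale /= /f''; field.
  by rewrite gt_eqF.
have f''0 x : 0 <= f'' x.
  by rewrite /f''; have := sqr_ge0 (1 / 2 - p * expR x / den x); lra.
have f0 : f 0 = 0.
  by rewrite /f /den expR0 mulr1 subrK ln1; lra.
have f'0 : f' 0 = 0 by rewrite /f' /den expR0 mulr1 subrK; lra.
exact: (second_order_ge0 df df' f''0 f0 f'0 u0).
Qed.

(** * Hoeffding's inequality for product weights on a finite alphabet *)

(** Chernoff's method: bound the indicator of the event by an exponential, factor the resulting sum,
    and bound each factor by the Bernoulli case. *)
Lemma hoeffding_fin (R : realType) (F : finType) (q g : F -> R) (M t : R)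
    (m : nat) :
  (forall a, 0 <= q a) -> \sum_a q a = 1 -> (forall a, 0 <= g a <= M) ->
  0 < M -> 0 <= t ->
  \sum_(w : {ffun 'I_m -> F} |
      m%:R * (\sum_a q a * g a + t) <= \sum_i g (w i)) \prod_i q (w i)
    <= expR (- 2 * m%:R * t ^+ 2 / M ^+ 2).
Proof.
move=> q0 q1 gM M0 t0; set mu := \sum_a q a * g a.
(* The exponent - s t + (s M)^2 / 8 is minimal at this s. *)
pose s := 4 * t / M ^+ 2.
have s0 : 0 <= s by rewrite divr_ge0 ?exprn_ge0 ?mulr_ge0 ?(ltW M0).
have mgf : \sum_a q a * expR (s * g a) <= expR (s * mu + (s * M) ^+ 2 / 8).
  have p01 : 0 <= mu / M <= 1.
    rewrite divr_ge0 ?(ltW M0)//=; last first.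
      by apply: sumr_ge0 => a _; rewrite mulr_ge0//; case/andP: (gM a).
    rewrite ler_pdivrMr// mul1r -[leRHS]mul1r -q1 mulr_suml.
    by apply: ler_sum => a _; apply: ler_wpM2l => //; case/andP: (gM a).
  (* By the chord bound, moving the mass of [g] to the endpoints 0 and [M] while keeping its mean
     can only increase the moment generating function. What remains is a Bernoulli variable of mean
     [mu / M] at parameter [s * M]. *)
  have := bernoulli_mgf_le (s * M) p01.
  have -> : mu / M * (s * M) = s * mu by field; rewrite gt_eqF.
  apply: le_trans.
  have -> : 1 - mu / M + mu / M * expR (s * M) =
      \sum_a q a * (1 - g a / M + g a / M * expR (s * M)).
    under [RHS]eq_bigr do rewrite mulrDr mulrBr mulr1 !mulrA.
    by rewrite big_split/= sumrB q1 -!mulr_suml.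
  apply: ler_sum => a _; apply: ler_wpM2l => //.
  have -> : s * g a = g a / M * (s * M) by field; rewrite gt_eqF.
  apply: expR_chord; case/andP: (gM a) => ga0 gaM.
  by rewrite divr_ge0 ?(ltW M0)//= ler_pdivrMr// mul1r.
(* Markov's step: on the event, the exponential of s (sum of g - m (mu + t)) is at least 1, and
   elsewhere it is nonnegative. *)
apply: (@le_trans _ _ (\sum_(w : {ffun 'I_m -> F})
    expR (- (s * (m%:R * (mu + t)))) * \prod_i (q (w i) * expR (s * g (w i))))).
  rewrite big_mkcond/=; apply: ler_sum => w _.
  rewrite big_split/= -expR_sum -mulr_sumr mulrCA -expRD.
  have pq0 : 0 <= \prod_i q (w i) by exact: prodr_ge0.
  case: ifPn => [le_w|_]; last by rewrite mulr_ge0// expR_ge0.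
  rewrite -[leLHS]mulr1; apply: ler_wpM2l => //.
  rewrite -[leLHS]expR0 ler_expR addrC subr_ge0.
  by apply: ler_wpM2l.
(* The sum over words of a product is a product of [m] equal sums over letters. *)
rewrite -mulr_sumr -(bigA_distr_bigA (fun _ a => q a * expR (s * g a)))/=.
rewrite prodr_const card_ord.
apply: (@le_trans _ _ (expR (- (s * (m%:R * (mu + t)))) *
    expR (s * mu + (s * M) ^+ 2 / 8) ^+ m)).
  apply: ler_wpM2l; first exact: expR_ge0.
  apply: lerXn2r => //; rewrite nnegrE ?expR_ge0//.
  by apply: sumr_ge0 => a _; rewrite mulr_ge0// expR_ge0.
rewrite -expRM_natl -expRD ler_expR le_eqVlt; apply/orP; left; apply/eqP.
by rewrite /s -mulr_natl; field; rewrite gt_eqF.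
Qed.

(** * Maps into a finite type: measurability, integrals and probabilities by fibers *)

Lemma fin_preimage_measurable d (T : measurableType d) (F : finType)
    (k : T -> F) (B : set F) :
  (forall a, measurable (k @^-1` [set a])) -> measurable (k @^-1` B).
Proof.
move=> mk; rewrite (_ : _ @^-1` _ = \bigcup_(a in B) k @^-1` [set a]).
  by apply: fin_bigcup_measurable => //; exact: finite_finset.
by apply/seteqP; split=> [x Bx|x [a /[swap] /= <-]//]; exists (k x).
Qed.

Lemma fin_measurable_comp d d' (T : measurableType d) (U : measurableType d')
    (F : finType) (k : T -> F) (f : F -> U) :
  (forall a, measurable (k @^-1` [set a])) -> measurable_fun setT (f \o k).
Proof.
move=> mk _ B mB; rewrite setTI comp_preimage.
exact: fin_preimage_measurable.
Qed.

Lemma integral_fin_comp d (T : measurableType d) (R : realType)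
    (mu : probability T R) (F : finType) (k : T -> F) (f : F -> R) :
  (forall a, measurable (k @^-1` [set a])) ->
  (\int[mu]_x (f (k x))%:E =
   (\sum_a fine (mu (k @^-1` [set a])) * f a)%:E)%E.
Proof.
move=> mk.
have UT : setT = \big[setU/set0]_(a <- enum F) k @^-1` [set a].
  rewrite -bigcup_seq; apply/seteqP; split => [x _|//].
  by exists (k x) => //=; rewrite mem_enum.
have tk : trivIset [set` enum F] (fun a => k @^-1` [set a]).
  apply/trivIsetP => a b _ _ /eqP ab; rewrite -subset0 => x [/= ka kb].
  by apply: ab; rewrite -ka -kb.
rewrite [in LHS]UT integral_bigsetU_EFin ?enum_uniq//; last first.
  apply: measurable_funTS; apply/measurable_EFinP.
  exact: (fin_measurable_comp f mk).
rewrite big_enum /= -sumEFin; apply: eq_bigr => a _.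
under eq_integral => x /set_mem /= -> do over.
rewrite integral_cst// muleC EFinM fineK//.
exact: fin_num_measure.
Qed.

Lemma prob_fin_preimage d (T : measurableType d) (R : realType)
    (mu : probability T R) (F : finType) (k : T -> F) (P : pred F) :
  (forall a, measurable (k @^-1` [set a])) ->
  fine (mu [set x | P (k x)]) = \sum_(a | P a) fine (mu (k @^-1` [set a])).
Proof.
move=> mk; have mP := fin_preimage_measurable [set` P] mk.
have := integral_fin_comp mu (fun a => (P a)%:R) mk.
under eq_integral => x _.
  rewrite (_ : (P (k x))%:R = \1_(k @^-1` [set` P]) x); last first.
    by rewrite indicE mem_setE.
  over.
rewrite integral_indic// setIT => -> /=.
by rewrite [RHS]big_mkcond/=; apply: eq_bigr => a _; rewrite mulr_natr mulrb.
Qed.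

Lemma sum_fibers_prob d (T : measurableType d) (R : realType)
    (mu : probability T R) (F : finType) (k : T -> F) :
  (forall a, measurable (k @^-1` [set a])) ->
  \sum_a fine (mu (k @^-1` [set a])) = 1.
Proof.
move=> mk; rewrite -(prob_fin_preimage mu predT mk).
by rewrite (_ : [set x | _] = setT) ?probability_setT//; apply/seteqP; split.
Qed.

(** * Hoeffding's inequality for finitely labelled i.i.d. samples *)

(** The fiber over a word is the intersection over all indices of preimages of letters, so
    independence for the full index set gives a product. This turns probabilities on [Omega] into
    the weighted sums of [hoeffding_fin]. *)
Lemma iid_fin_law dO (Omega : measurableType dO) dZ (Z : measurableType dZ)
    (R : realType) (Pr : probability Omega R) (m : nat)
    (S : 'I_m -> {mfun Omega >-> Z}) (Q : probability Z R)
    (F : finType) (k : Z -> F) (w : {ffun 'I_m -> F}) :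
  (forall a, measurable (k @^-1` [set a])) -> iid_samples Pr Q S ->
  measurable ((fun x => [ffun i => k (S i x)]) @^-1` [set w]) /\
  fine (Pr ((fun x => [ffun i => k (S i x)]) @^-1` [set w])) =
  \prod_i fine (Q (k @^-1` [set w i])).
Proof.
move=> mk [indep law].
have -> : (fun x => [ffun i => k (S i x)]) @^-1` [set w] =
    \bigcap_(i in [set i | i \in [set: 'I_m]%SET])
      (S i @^-1` (k @^-1` [set w i])).
  apply/seteqP; split => [x /= <- i _ /=|x xw /=]; first by rewrite ffunE.
  by apply/ffunP => i; rewrite ffunE; apply: xw; rewrite /= inE.
split.
  apply: fin_bigcap_measurable; first exact: finite_finset.
  by move=> i _; rewrite -[X in measurable X]setTI; exact: measurable_funP.
rewrite (indep [set: 'I_m]%SET (fun i => k @^-1` [set w i]))//.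
rewrite (eq_bigr (fun i => (fine (Q (k @^-1` [set w i])))%:E)); last first.
  by move=> i _; rewrite fineK ?fin_num_measure//; exact: law.
rewrite prodEFin /=.
by apply: eq_bigl => i; rewrite inE.
Qed.

Lemma hoeffding_iid dO (Omega : measurableType dO) dZ (Z : measurableType dZ)
    (R : realType) (Pr : probability Omega R) (m : nat)
    (S : 'I_m -> {mfun Omega >-> Z}) (Q : probability Z R)
    (F : finType) (k : Z -> F) (g : F -> R) (M t : R) :
  (forall a, measurable (k @^-1` [set a])) -> iid_samples Pr Q S ->
  (forall a, 0 <= g a <= M) -> 0 < M -> 0 <= t ->
  fine (Pr [set x | m%:R * (\sum_a fine (Q (k @^-1` [set a])) * g a + t) <=
             \sum_i g (k (S i x))])
    <= expR (- 2 * m%:R * t ^+ 2 / M ^+ 2).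
Proof.
move=> mk iid gM M0 t0.
set q := fun a => fine (Q (k @^-1` [set a])).
have q0 a : 0 <= q a by exact: fine_ge0.
have := hoeffding_fin m q0 (sum_fibers_prob Q mk) gM M0 t0.
apply: le_trans.
set P := fun w : {ffun 'I_m -> F} => m%:R * (\sum_a q a * g a + t) <=
             \sum_i g (w i).
have := prob_fin_preimage Pr P (fun w => (iid_fin_law w mk iid).1).
under [X in _ = X]eq_bigr do rewrite (iid_fin_law _ mk iid).2.
have eS x : \sum_i g ([ffun i => k (S i x)] i) = \sum_i g (k (S i x)).
  by apply: eq_bigr => i _; rewrite ffunE.
move=> <-; rewrite le_eqVlt; apply/orP; left; apply/eqP.
by congr (fine (Pr _)); apply/seteqP; rewrite /P; split => x /=; rewrite eS.
Qed.

(** The upper tail applied to [M - g], which also ranges in [0, M]. *)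
Lemma hoeffding_iid_lower dO (Omega : measurableType dO)
    dZ (Z : measurableType dZ)
    (R : realType) (Pr : probability Omega R) (m : nat)
    (S : 'I_m -> {mfun Omega >-> Z}) (Q : probability Z R)
    (F : finType) (k : Z -> F) (g : F -> R) (M t : R) :
  (forall a, measurable (k @^-1` [set a])) -> iid_samples Pr Q S ->
  (forall a, 0 <= g a <= M) -> 0 < M -> 0 <= t ->
  fine (Pr [set x | \sum_i g (k (S i x)) <=
             m%:R * (\sum_a fine (Q (k @^-1` [set a])) * g a - t)])
    <= expR (- 2 * m%:R * t ^+ 2 / M ^+ 2).
Proof.
move=> mk iid gM M0 t0.
have gM' a : 0 <= M - g a <= M by have := gM a; lra.
have := hoeffding_iid mk iid gM' M0 t0.
apply: le_trans; rewrite le_eqVlt; apply/orP; left; apply/eqP.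
congr (fine (Pr _)); apply/seteqP.
under [X in m%:R * (X + t)]eq_bigr do rewrite mulrBr.
rewrite sumrB -mulr_suml sum_fibers_prob// mul1r.
have eS x : \sum_(i < m) (M - g (k (S i x))) =
    m%:R * M - \sum_(i < m) g (k (S i x)).
  by rewrite sumrB sumr_const card_ord mulr_natl.
by split => x /=; rewrite eS; nra.
Qed.

(** * Point masses under the boundedness assumption *)

Section atoms.
Context d (Y : measurableType d) (R : realType).
Hypothesis mY1 : forall y : Y, measurable [set y].

Definition atom (P : probability Y R) (y : Y) : R := fine (P [set y]).

Lemma atomE (P : probability Y R) y : P [set y] = (atom P y)%:E.
Proof. by rewrite /atom fineK// fin_num_measure. Qed.

Lemma atom_le1 (P : probability Y R) y : atom P y <= 1.
Proof. by rewrite -lee_fin -atomE probability_le1. Qed.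

Context (PP : set (probability Y R)) (M : R).
Hypothesis bndPP : bounded_class PP M.

(** A zero mass would have inverse [+oo], hence an infinite logarithm, which exceeds the real number
    [M]. *)
Lemma atom_gt0 (P : probability Y R) y : PP P -> 0 < atom P y.
Proof.
move=> PPP; rewrite lt_neqAle fine_ge0// andbT eq_sym; apply/eqP => P0.
by have := bndPP y PPP; rewrite atomE P0 inver eqxx.
Qed.

Lemma log_loss_atom (P : probability Y R) y : PP P ->
  0 <= - ln (atom P y) <= M.
Proof.
move=> PPP; have p0 := atom_gt0 y PPP.
rewrite oppr_ge0 ln_le0 ?atom_le1//=.
have := bndPP y PPP.
by rewrite atomE inver gt_eqF// lneV// lne_EFin// -EFinN lee_fin.
Qed.

(** Each outcome has mass at least [expR (- M)], so more than [expR M] distinct outcomes would have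
    total mass above 1. *)
Lemma bounded_class_finite (P : probability Y R) : PP P ->
  finite_set [set: Y].
Proof.
move=> PPP; apply: contrapT => /(infinite_set_fset (Num.truncn (expR M)).+1).
move=> [B _ sB].
have : (\sum_(y <- finmap.enum_fset B) P [set y] <= 1)%E.
  rewrite -measure_fbigsetU//; last first.
    by apply/trivIsetP => a b _ _ /eqP ab; rewrite -subset0 => x [/= -> /ab].
  by apply: probability_le1; apply: bigsetU_measurable.
under eq_bigr do rewrite atomE.
rewrite sumEFin lee_fin; apply/negP; rewrite -ltNge.
apply: (@lt_le_trans _ _ (\sum_(y <- finmap.enum_fset B) expR (- M))).
  rewrite big_const_seq count_predT iter_addr_0.
  rewrite -mulr_natr expRN mulrC ltr_pdivlMr ?expR_gt0// mul1r.
  apply: (lt_le_trans (truncnS_gt (expR M))).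
  by rewrite ler_nat.
apply: ler_sum => y _; rewrite -[leRHS]lnK ?posrE ?atom_gt0// ler_expR.
by have := log_loss_atom y PPP; lra.
Qed.

End atoms.
Arguments atom {d Y R} P y.

(** Provides a [finType] copy of the outcome space, over which finite sums can be indexed. *)
Lemma finite_type_bij (Y : choiceType) : finite_set [set: Y] ->
  exists (F : finType) (k : Y -> F) (v : F -> Y), cancel k v /\ cancel v k.
Proof.
move=> /finite_seqP [s Ys].
have ys y : y \in s by have : [set: Y] y by []; rewrite Ys.
exists (seq_sub s), (fun y => SeqSub (ys y)), (@ssval _ s).
by split => // -[y ysy]; apply/val_inj.
Qed.

(** * The divergence as a finite sum *)

Lemma KL_sum d (Y : measurableType d) (R : realType)
    (F : finType) (k : Y -> F) (v : F -> Y) (P Q : probability Y R) :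
  (forall y : Y, measurable [set y]) ->
  cancel k v -> cancel v k ->
  (forall y, 0 < atom P y) -> (forall y, 0 < atom Q y) ->
  KL P Q = (\sum_a atom P (v a) *
    (ln (atom P (v a)) - ln (atom Q (v a))))%:E.
Proof.
move=> mY1 kK vK P0 Q0.
have fib a : k @^-1` [set a] = [set v a].
  apply/seteqP; split => x /= => [<-|->]; by rewrite ?kK ?vK.
(* Every point has positive [Q] mass, so the only measurable [Q]-null set is empty. *)
have PQ : P `<< Q.
  move=> N NQ A mA AN; suff -> : A = set0 by rewrite measure0.
  rewrite -subset0 => y Ay /=.
  have yN : [set y] `<=` N by move=> _ ->; exact: AN.
  by have /eqP := NQ _ (mY1 y) yN; rewrite atomE// eqe gt_eqF.
rewrite /KL; case: asboolP => // _.
(* The derivative is determined at every point, not just almost everywhere: integrating it over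
   [[set y]] multiplies its value by the positive mass [atom Q y] and must give [atom P y]. *)
have RN y : Radon_Nikodym (charge_of_finite_measure P) Q y =
    (atom P y / atom Q y)%:E.
  have := @Radon_Nikodym_integral _ _ R (charge_of_finite_measure P) Q
    [set y] PQ (mY1 y).
  rewrite (eq_integral (cst (Radon_Nikodym (charge_of_finite_measure P) Q y)));
    last by move=> x /set_mem /= ->.
  rewrite integral_cst//= /charge_of_finite_measure !atomE//.
  have := @Radon_Nikodym_fin_num _ _ R (charge_of_finite_measure P) Q y PQ.
  move: (Radon_Nikodym _ _ _) => [r _ /=||]//.
  rewrite -EFinM => -[->]; rewrite mulfK// gt_eqF//.
pose f a := ln (atom P (v a)) - ln (atom Q (v a)).
rewrite (eq_integral (fun y => (f (k y))%:E)); last first.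
  move=> y _; rewrite RN /f kK lne_EFin ?divr_gt0//.
  by rewrite lnM ?posrE ?invr_gt0// lnV ?posrE.
rewrite integral_fin_comp; last by move=> a; rewrite fib.
by congr EFin; apply: eq_bigr => a _; rewrite fib.
Qed.

(** * Error and mean loss in terms of finitely many labels *)

Section labels.
Context dX (X : measurableType dX) dY (Y : measurableType dY) (R : realType).
Hypothesis mY1 : forall y : Y, measurable [set y].
Context (F : finType) (k : Y -> F) (v : F -> Y).
Hypotheses (kK : cancel k v) (vK : cancel v k).
Context (D : probability X R) (c : {mfun X >-> bool}).
Context (P0 P1 : probability Y R).
Hypothesis P0_gt0 : forall y, 0 < atom P0 y.
Hypothesis P1_gt0 : forall y, 0 < atom P1 y.

Definition loss (T : model X Y R) (z : X * Y) : R :=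
  - ln (atom (predicted T z.1) z.2).

(** The conditional entropy of the outcome given the context. No model enters it, so it is a common
    offset of all mean losses. *)
Definition entropy : R :=
  fine (\int[Gen D c P0 P1]_z
    (- ln (atom (label_dist P0 P1 (c z.1)) z.2))%:E).

(** The first component fixes the law of the outcome, the second the predicted law; the divergence
    at [x] depends on nothing else. *)
Definition label2 (h : {mfun X >-> bool}) (x : X) : bool * bool := (c x, h x).

Definition label3 (h : {mfun X >-> bool}) (z : X * Y) : bool * bool * F :=
  (label2 h z.1, k z.2).

Lemma label2_measurable h a : measurable (label2 h @^-1` [set a]).
Proof.
case: a => a b; rewrite (_ : _ @^-1` _ = c @^-1` [set a] `&` h @^-1` [set b]).
  by apply: measurableI; rewrite -[X in measurable X]setTI;
    exact: measurable_funP.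
by apply/seteqP; split => x /= [ca hb]; rewrite /label2 ca hb.
Qed.

Lemma label3_fiber h a f :
  label3 h @^-1` [set (a, f)] = (label2 h @^-1` [set a]) `*` [set v f].
Proof.
apply/seteqP; split => -[x y] /=.
  by move=> [<- <-]; rewrite kK.
by move=> [<- ->]; rewrite /label3/= vK.
Qed.

Lemma label3_measurable h a : measurable (label3 h @^-1` [set a]).
Proof.
case: a => a f; rewrite label3_fiber.
by apply: measurableX => //; exact: label2_measurable.
Qed.

(** The section of the fiber at [x] is the single outcome [v f] when [x] has label [a], and empty
    otherwise. *)
Lemma Gen_fiber h a f :
  fine (Gen D c P0 P1 (label3 h @^-1` [set (a, f)])) =
  fine (D (label2 h @^-1` [set a])) * atom (label_dist P0 P1 a.1) (v f).
Proof.
pose phi (b : bool * bool) : R :=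
  if b == a then atom (label_dist P0 P1 a.1) (v f) else 0.
rewrite /Gen/= /gen.
rewrite (eq_integral (fun x => (phi (label2 h x))%:E)).
  rewrite integral_fin_comp; last exact: label2_measurable.
  rewrite /= (bigD1 a)//= /phi eqxx big1 ?addr0// => b /negPf ->.
  by rewrite mulr0.
move=> x _; rewrite label3_fiber /phi; case: ifPn => [/eqP <-|xa].
  by rewrite in_xsectionX ?mem_set// atomE.
rewrite notin_xsectionX ?measure0// notin_setE => /= /eqP.
by rewrite (negPf xa).
Qed.

(** Writes the error as the mean of a log-likelihood ratio under [Gen], the same law that governs
    the mean loss. In particular it is finite. *)
Lemma err_sum T : (forall y, 0 < atom (dist0 T) y) ->
  (forall y, 0 < atom (dist1 T) y) ->
  err D c P0 P1 T =
  (\sum_z fine (Gen D c P0 P1 (label3 (hyp T) @^-1` [set z])) *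
     (ln (atom (label_dist P0 P1 z.1.1) (v z.2))
      - ln (atom (label_dist (dist0 T) (dist1 T) z.1.2) (v z.2))))%:E.
Proof.
move=> T0 T1; rewrite /err.
pose phi (a : bool * bool) : R :=
  \sum_f atom (label_dist P0 P1 a.1) (v f) *
   (ln (atom (label_dist P0 P1 a.1) (v f))
      - ln (atom (label_dist (dist0 T) (dist1 T) a.2) (v f))).
rewrite (eq_integral (fun x => (phi (label2 (hyp T) x))%:E)); last first.
  move=> x _; rewrite /predicted (KL_sum mY1 kK vK)//.
  - by move=> y; rewrite /label_dist; case: ifP.
  - by move=> y; rewrite /label_dist; case: ifP.
rewrite integral_fin_comp; last exact: label2_measurable.
congr EFin; transitivity (\sum_a \sum_f (
   fine (Gen D c P0 P1 (label3 (hyp T) @^-1` [set (a, f)])) *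
     (ln (atom (label_dist P0 P1 a.1) (v f))
      - ln (atom (label_dist (dist0 T) (dist1 T) a.2) (v f))))); last first.
  by rewrite pair_bigA; apply: eq_bigr => -[a f].
apply: eq_bigr => a _; rewrite mulr_sumr; apply: eq_bigr => f _.
by rewrite Gen_fiber mulrA.
Qed.

(** Split - log Q as (log P - log Q) + (- log P), with P the true and Q the predicted law: the first
    term averages to the error, the second to the entropy. *)
Lemma mean_loss T : (forall y, 0 < atom (dist0 T) y) ->
  (forall y, 0 < atom (dist1 T) y) ->
  \sum_z fine (Gen D c P0 P1 (label3 (hyp T) @^-1` [set z])) *
     - ln (atom (label_dist (dist0 T) (dist1 T) z.1.2) (v z.2)) =
  fine (err D c P0 P1 T) + entropy.
Proof.
move=> T0 T1; rewrite err_sum//= /entropy.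
pose phi (z : bool * bool * F) : R :=
  - ln (atom (label_dist P0 P1 z.1.1) (v z.2)).
rewrite (eq_integral (fun z => (phi (label3 (hyp T) z))%:E)); last first.
  by move=> z _; rewrite /phi/= kK.
rewrite integral_fin_comp; last exact: label3_measurable.
by rewrite /= -big_split/=; apply: eq_bigr => z _; rewrite /phi; ring.
Qed.

Lemma loss_label3 T z : loss T z =
  - ln (atom (label_dist (dist0 T) (dist1 T) (label3 (hyp T) z).1.2)
             (v (label3 (hyp T) z).2)).
Proof. by rewrite /loss /predicted/= kK. Qed.

Lemma loss_measurable T : measurable_fun setT (loss T).
Proof.
have := fin_measurable_comp
  (fun z : bool * bool * F =>
     - ln (atom (label_dist (dist0 T) (dist1 T) z.1.2) (v z.2)))
  (label3_measurable (hyp T)).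
by congr measurable_fun; apply/funext => z /=; rewrite loss_label3.
Qed.

End labels.
Arguments loss {dX X dY Y R} T z.
Arguments entropy {dX X dY Y R} D c P0 P1.

(** * Enumeration of the models and the union bound *)

(** The enumeration is total on [nat], with default [x0] from [N] on, so [f j] lies in [A] for every
    [j]. *)
Lemma card_I_enum (T : Type) (A : set T) (N : nat) (x0 : T) : A x0 ->
  (A #= `I_N)%card ->
  exists f : nat -> T, (forall j, A (f j)) /\
    forall x, A x -> exists2 j, (j < N)%N & x = f j.
Proof.
move=> Ax0 /card_set_bijP[e [eA einj esurj]].
have : forall j, exists x, A x /\ ((j < N)%N -> e x = j).
  move=> j; case: (ltnP j N) => jN; last by exists x0.
  by have [x Ax exj] := esurj j jN; exists x.
move=> /choice[f fP]; exists f; split=> [j|x Ax]; first by case: (fP j).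
exists (e x); first exact: eA.
have [Af /(_ (eA _ Ax)) efx] := fP (e x).
by apply: einj; rewrite ?inE.
Qed.

Lemma log_loss_sum dX (X : measurableType dX) dY (Y : measurableType dY)
    (R : realType) (s : seq (X * Y)) (T : model X Y R) :
  (forall y : Y, measurable [set y]) ->
  (forall y, 0 < atom (dist0 T) y) -> (forall y, 0 < atom (dist1 T) y) ->
  log_loss s T = (\sum_(z <- s) loss T z)%:E.
Proof.
move=> mY1 T0 T1; rewrite /log_loss -sumEFin; apply: eq_bigr => z _.
rewrite atomE// lne_EFin -?EFinN// /predicted /label_dist.
by case: ifP.
Qed.

Local Open Scope ereal_scope.

Unset Implicit Arguments.

Theorem theorem5 (R : realType)
    (dX dY : measure_display)
    (X : measurableType dX) (Y : measurableType dY)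
    (mY1 : forall y : Y, measurable [set y])
    (C : set {mfun X >-> bool}) (PP : set (probability Y R))
    (M : R) (bndPP : bounded_class PP M)
    (D : probability X R) (c : {mfun X >-> bool}) (P0 P1 : probability Y R)
    (Cc : C c) (PP0 : PP P0) (PP1 : PP P1)
    (epsilon : R) (epsilon_gt0 : (0 < epsilon)%R)
    (N : nat) (TT : set (model X Y R))
    (cardTT : (TT #= `I_N)%card)
    (TTmodels : forall T, TT T -> in_classes C PP T)
    (TTgood : exists2 Tstar, TT Tstar & err D c P0 P1 Tstar <= epsilon%:E)
    (dO : measure_display) (Omega : measurableType dO)
    (Pr : probability Omega R)
    (m : nat) (S : 'I_m -> {mfun Omega >-> (X * Y)%type})
    (iidS : iid_samples Pr (Gen D c P0 P1) S) :
  let sample (w : Omega) : seq (X * Y) := [seq S i w | i <- enum 'I_m] in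
  let success : set Omega := [set w |
    (exists That, max_likelihood_output TT (sample w) That) /\
    (forall That, max_likelihood_output TT (sample w) That ->
       err D c P0 P1 That <= (4 * epsilon)%:E)] in
  exists2 delta : R,
    (delta <= (N%:R + 1) * expR (- 2 * m%:R * epsilon ^+ 2 / M ^+ 2))%R &
    measurable success /\ (1 - delta)%:E <= Pr success.
Proof.
move=> sample success.
have [F [k [v [kK vK]]]] :=
  finite_type_bij (bounded_class_finite mY1 bndPP PP0).
have p0 P y (PPP : PP P) : (0 < atom P y)%R := atom_gt0 mY1 bndPP y PPP.
have p0_gt0 y := p0 P0 y PP0.
have p1_gt0 y := p0 P1 y PP1.
have T0_gt0 T y : TT T -> (0 < atom (dist0 T) y)%R.
  by case/TTmodels=> *; exact: p0.
have T1_gt0 T y : TT T -> (0 < atom (dist1 T) y)%R.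
  by case/TTmodels=> *; exact: p0.
case: TTgood => Tstar TTstar errstar.
have [f [TTf fTT]] := card_I_enum TTstar cardTT.
(* Positive point masses make losses and errors finite; [L] and [e] are their real-valued
   versions. *)
pose L (T : model X Y R) w := (\sum_(i < m) loss T (S i w))%R.
have LE w T : TT T -> log_loss (sample w) T = (L T w)%:E.
  move=> TTT; rewrite log_loss_sum// => [|y|y]; [|exact: T0_gt0|exact: T1_gt0].
  by rewrite /sample big_map big_enum.
have mL T : measurable_fun setT (L T).
  apply: measurable_sum => i; apply: measurableT_comp => //.
  exact: (loss_measurable mY1 kK vK c).
pose e (T : model X Y R) := fine (err D c P0 P1 T).
have errE T : TT T -> err D c P0 P1 T = (e T)%:E.
  move=> TTT; rewrite /e (err_sum mY1 kK vK)// => y.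
    exact: T0_gt0.
  exact: T1_gt0.
pose bad T := (4 * epsilon < e T)%R.
(* Success means that every bad model is strictly beaten by some model. This removes the quantifiers
   over minimizers and exhibits a countable combination of comparisons of two losses, hence a
   measurable set. *)
have successE : success = \bigcap_(j in [set j | (j < N)%N /\ bad (f j)])
    \bigcup_(i in `I_N) [set w | (L (f i) w < L (f j) w)%R].
  apply/seteqP; split => w /=.
    move=> [_ good] j [jN badj]; apply: contrapT => noi.
    have : max_likelihood_output TT (sample w) (f j).
      split=> // T' TT'; rewrite !LE// lee_fin leNgt; apply/negP => lt.
      by apply: noi; have [i iN Ti] := fTT _ TT'; exists i => //=; rewrite -Ti.
    by move=> /good; rewrite errE// lee_fin leNgt => /negP.
  move=> win; split.
    (* The index of [Tstar] shows that ['I_N] is inhabited, so a minimizer exists. *)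
    have [i0 i0N _] := fTT _ TTstar.
    have [/= i _ imin] :=
      @arg_minP _ R _ (Ordinal i0N) xpredT (fun i => L (f i) w) isT.
    exists (f i); split => // T' TT'; have [j jN ->] := fTT _ TT'.
    by rewrite !LE// lee_fin; exact: (imin (Ordinal jN)).
  move=> T [TTT Tmin]; rewrite errE// lee_fin leNgt; apply/negP => badT.
  have [j jN Tj] := fTT _ TTT.
  have [|i iN /=] := win j; first by split => //; rewrite /bad -Tj.
  by rewrite ltNge -lee_fin -!LE// -Tj Tmin.
have mlt T T' : measurable [set w | (L T w < L T' w)%R].
  rewrite -[X in measurable X]setTI.
  rewrite (_ : [set w | _] = (fun w => L T w < L T' w)%R @^-1` [set true]);
    last by apply/seteqP; split => w /=.
  exact: measurable_fun_ltr.
have mle T a : measurable [set w | (a <= L T w)%R].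
  rewrite -[X in measurable X]setTI.
  exact: measurable_fun_le.
have mge T a : measurable [set w | (L T w <= a)%R].
  rewrite -[X in measurable X]setTI.
  exact: measurable_fun_le.
have msuccess : measurable success.
  rewrite successE; apply: bigcap_measurableType => j _.
  by apply: bigcup_measurable => i _.
have M_ge0 : (0 <= M)%R.
  have [y _] : [set: Y] !=set0.
    apply/set0P/eqP => Y0; have := probability_setT P0.
    by rewrite Y0 measure0 => /eqP; rewrite eqe eq_sym oner_eq0.
  by have := log_loss_atom mY1 bndPP y PP0; lra.
(* For M = 0 the division by M ^+ 2 yields 0 and the bound is N + 1. *)
have [M0|M_neq0] := eqVneq M 0%R.
  exists 1%R; last by split => //; rewrite subrr.
  by rewrite M0 expr0n/= invr0 mulr0 expR0 mulr1 lerDr.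
have M_gt0 : (0 < M)%R by rewrite lt_neqAle eq_sym M_neq0.
pose H := entropy D c P0 P1.
set beta := expR _.
(* The mean loss per sample of a model is [e T + H]. In [U] the loss of [Tstar] exceeds its mean by
   at least m epsilon; in [V j] the loss of a bad [f j] falls short of its mean by as much. Setting
   [V j] empty for the other models allows a union over all [j < N]. *)
pose U := [set w | (m%:R * (e Tstar + H + epsilon) <= L Tstar w)%R].
pose V j :=
  if bad (f j) then [set w | (L (f j) w <= m%:R * (e (f j) + H - epsilon))%R]
  else set0.
pose g (T : model X Y R) (a : bool * bool * F) : R :=
  (- ln (atom (label_dist (dist0 T) (dist1 T) a.1.2) (v a.2)))%R.
have ghyp T (a : bool * bool * F) : TT T -> (0 <= g T a <= M)%R.
  move=> /TTmodels[_ d0 d1]; apply: (log_loss_atom mY1 bndPP).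
  by rewrite /label_dist; case: ifP.
have mlabel (T : model X Y R) : forall a,
    measurable (label3 k c (hyp T) @^-1` [set a]).
  exact: (label3_measurable mY1 kK vK c (hyp T)).
have meanE T : TT T -> (\sum_a fine (Gen D c P0 P1
    (label3 k c (hyp T) @^-1` [set a])) * g T a = e T + H)%R.
  move=> TTT; apply: (mean_loss mY1 kK vK D c p0_gt0 p1_gt0) => y.
    exact: T0_gt0.
  exact: T1_gt0.
have Lg T w : L T w = (\sum_(i < m) g T (label3 k c (hyp T) (S i w)))%R.
  by apply: eq_bigr => i _; exact: (loss_label3 kK c).
have mU : measurable U by exact: mle.
have PrU : Pr U <= beta%:E.
  rewrite -[Pr U]fineK ?fin_num_measure// lee_fin.
  have := hoeffding_iid (mlabel Tstar) iidS (fun a => ghyp Tstar a TTstar) M_gt0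
    (ltW epsilon_gt0).
  rewrite meanE//; apply: le_trans; rewrite le_eqVlt; apply/orP; left.
  apply/eqP; congr (fine (Pr _)); apply/seteqP; rewrite /U.
  by split => w /=; rewrite Lg.
have PrV j : Pr (V j) <= beta%:E.
  rewrite /V; case: ifPn => _; last by rewrite measure0 lee_fin expR_ge0.
  rewrite -[Pr _]fineK ?(fin_num_measure Pr _ (mge _ _))// lee_fin.
  have := hoeffding_iid_lower (mlabel (f j)) iidS
    (fun a => ghyp (f j) a (TTf j)) M_gt0 (ltW epsilon_gt0).
  rewrite meanE//; apply: le_trans; rewrite le_eqVlt; apply/orP; left.
  by apply/eqP; congr (fine (Pr _)); apply/seteqP; split => w /=; rewrite Lg.
have mV j : measurable (V j) by rewrite /V; case: ifP.
have cover : ~` success `<=` U `|` \big[setU/set0]_(j < N) V j.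
  move=> w nsw; apply: contrapT => /not_orP[nU nV]; apply: nsw.
  rewrite successE => j [jN badj].
  have [i iN fi] := fTT _ TTstar; exists i => //=; rewrite -fi.
  have ltU : (L Tstar w < m%:R * (e Tstar + H + epsilon))%R.
    by rewrite ltNge; apply/negP.
  have ltV : (m%:R * (e (f j) + H - epsilon) < L (f j) w)%R.
    rewrite ltNge; apply/negP => Vw; apply: nV.
    rewrite -bigcup_mkord; exists j => //.
    by rewrite /V badj.
  (* The gap: [e Tstar + epsilon] is at most 2 epsilon, while [e (f j) - epsilon] is above 3
     epsilon. This middle comparison is weak after multiplication by [m], which may be 0; strictness
     comes from the outer two. *)
  apply: (lt_trans ltU); apply: le_lt_trans ltV.
  apply: ler_wpM2l => //.
  by move: errstar badj; rewrite errE// lee_fin /bad; lra.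
(* Take delta to be the exact failure probability. The cover bounds it by one term for [U] and [N]
   terms for the [V j], each at most [beta]. *)
exists (fine (Pr (~` success))).
  rewrite -lee_fin fineK ?fin_num_measure//; last exact: measurableC.
  have mUV : measurable (\big[setU/set0]_(j < N) V j).
    exact: bigsetU_measurable.
  apply: (@le_trans _ _ (Pr (U `|` \big[setU/set0]_(j < N) V j))).
    apply: le_measure cover; apply/mem_set; first exact: measurableC.
    exact: measurableU.
  apply: (le_trans (measureU2 _ _ _)) => //.
  rewrite mulrDl mul1r EFinD addeC; apply: leeD => //.
  apply: (le_trans (Boole_inequality _ _)) => //.
  apply: (@le_trans _ _ (\sum_(j < N) beta%:E)).
    by apply: lee_sum => j _; exact: PrV.
  by rewrite sumEFin lee_fin sumr_const card_ord mulr_natl.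
split => //.
rewrite EFinB fineK ?fin_num_measure//; last exact: measurableC.
by rewrite probability_setC// oppeB// ?fin_num_measure// addeA subee// add0e.
Qed.
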